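(* Let $M$ be a finite-dimensional free $\mathbb{T}$-module equipped with a bicomplex scalar product that is hyperbolic positive, and let $\{|s_l\rangle\}$ be an arbitrary basis of $M$. Then one can always find bicomplex linear combinations of the $|s_l\rangle$ which make up an orthogonal basis of $M$.
   Context: Bicomplex numbers: $\mathbb{T}$ is the commutative ring of elements $w=z_1+z_2\mathbf{i_2}$ with $z_1,z_2\in\mathbb{C}(\mathbf{i_1})=\{x+y\mathbf{i_1}: x,y\in\mathbb{R}\}$ (a copy of the complex field), where $\mathbf{i_1}^2=\mathbf{i_2}^2=-1$ and $\mathbf{i_1}\mathbf{i_2}=\mathbf{i_2}\mathbf{i_1}=\mathbf{j}$, so $\mathbf{j}^2=1$. Put $\mathbf{e_1}=(1+\mathbf{j})/2$, $\mathbf{e_2}=(1-\mathbf{j})/2$; then $\mathbf{e_k}^2=\mathbf{e_k}$, $\mathbf{e_1}\mathbf{e_2}=0$, $\mathbf{e_1}+\mathbf{e_2}=1$, and every $w\in\mathbb{T}$ is uniquely $w=\mathbf{e_1}w_{\hat 1}+\mathbf{e_2}w_{\hat 2}$ with $w_{\hat 1},w_{\hat 2}\in\mathbb{C}(\mathbf{i_1})$. The conjugation $\dag_3$ is $w^{\dag_3}=\bar z_1-\bar z_2\mathbf{i_2}$, equivalently $w^{\dag_3}=\mathbf{e_1}\overline{w_{\hat 1}}+\mathbf{e_2}\overline{w_{\hat 2}}$. $\mathbb{D}^+=\{\mathbf{e_1}x_1+\mathbf{e_2}x_2: x_1,x_2\in\mathbb{R},\ x_1,x_2\ge 0\}$.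 A finite-dimensional free $\mathbb{T}$-module is a $\mathbb{T}$-module with a finite basis (linearly independent generating set). A bicomplex scalar product on $M$ is a map $(\cdot,\cdot):M\times M\to\mathbb{T}$ that is additive and $\mathbb{T}$-homogeneous in the second argument, satisfies $(|\psi\rangle,|\phi\rangle)=(|\phi\rangle,|\psi\rangle)^{\dag_3}$, and $(|\psi\rangle,|\psi\rangle)=0$ iff $|\psi\rangle=0$. It is hyperbolic positive if $(|\psi\rangle,|\psi\rangle)\in\mathbb{D}^+$ for all $|\psi\rangle\in M$. A basis is orthogonal if any two distinct elements have scalar product $0$. *)

(* Defs.v *)
From HB Require Import structures.
From mathcomp Require Import all_boot all_order all_algebra.
From mathcomp Require Import ring complex reals.

Set Implicit Arguments.
Unset Strict Implicit.
Unset Printing Implicit Defensive.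

Import Order.TTheory GRing.Theory Num.Theory.
Local Open Scope ring_scope.
Local Open Scope complex_scope.

(* [Bicomplex z1 z2] is z1 + z2 i2, where C(i1) is R[i]. *)
Record bicomplex (R : Type) : Type := Bicomplex { bc1 : R[i]; bc2 : R[i] }.

Definition pair_of_bicomplex (R : Type) (w : bicomplex R) := (bc1 w, bc2 w).
Definition bicomplex_of_pair (R : Type) (p : R[i] * R[i]) := Bicomplex p.1 p.2.

Lemma pair_of_bicomplexK (R : Type) :
  cancel (@pair_of_bicomplex R) (@bicomplex_of_pair R).
Proof. by case. Qed.

HB.instance Definition _ (R : eqType) := Equality.copy (bicomplex R)
  (can_type (@pair_of_bicomplexK R)).
HB.instance Definition _ (R : choiceType) := Choice.copy (bicomplex R)
  (can_type (@pair_of_bicomplexK R)).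

Section BicomplexRing.
Variable R : realType.
Implicit Types u v w : bicomplex R.

Definition addbc v w := Bicomplex (bc1 v + bc1 w) (bc2 v + bc2 w).
Definition oppbc w := Bicomplex (- bc1 w) (- bc2 w).
Definition mulbc v w := Bicomplex (bc1 v * bc1 w - bc2 v * bc2 w)
                                  (bc1 v * bc2 w + bc2 v * bc1 w).

Lemma addbcA : associative addbc.
Proof. by move=> u v w; rewrite /addbc /= !addrA. Qed.
Lemma addbcC : commutative addbc.
Proof. by move=> v w; congr Bicomplex; rewrite addrC. Qed.
Lemma add0bc : left_id (Bicomplex 0 0) addbc.
Proof. by case=> a b; rewrite /addbc /= !add0r. Qed.
Lemma addNbc : left_inverse (Bicomplex 0 0) oppbc addbc.
Proof. by case=> a b; rewrite /addbc /= !addNr. Qed.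

HB.instance Definition _ := GRing.isZmodule.Build (bicomplex R)
  addbcA addbcC add0bc addNbc.

Lemma mulbcA : associative mulbc.
Proof. by case=> a b [c d] [e f]; congr Bicomplex; rewrite /=; ring. Qed.
Lemma mulbcC : commutative mulbc.
Proof. by case=> a b [c d]; congr Bicomplex; rewrite /=; ring. Qed.
Lemma mul1bc : left_id (Bicomplex 1 0) mulbc.
Proof. by case=> a b; congr Bicomplex; rewrite /=; ring. Qed.
Lemma mulbcDl : left_distributive mulbc +%R.
Proof. by case=> a b [c d] [e f]; congr Bicomplex; rewrite /=; ring. Qed.
Lemma nonzero1bc : Bicomplex 1 0 != 0 :> bicomplex R.
Proof. by apply/eqP => -[] /eqP; rewrite oner_eq0. Qed.

HB.instance Definition _ := GRing.Zmodule_isComNzRing.Build (bicomplex R)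
  mulbcA mulbcC mul1bc mulbcDl nonzero1bc.

End BicomplexRing.

Section BicomplexTheory.
Variable R : realType.
Implicit Types (z : R[i]) (w : bicomplex R).

Definition bc_of_complex z : bicomplex R := Bicomplex z 0.

Definition bc_i1 : bicomplex R := bc_of_complex 'i.
Definition bc_i2 : bicomplex R := Bicomplex 0 1.
Definition bc_j : bicomplex R := bc_i1 * bc_i2.
Definition bc_e1 : bicomplex R := bc_of_complex 2^-1 * (1 + bc_j).
Definition bc_e2 : bicomplex R := bc_of_complex 2^-1 * (1 - bc_j).

Definition dag3 w : bicomplex R := Bicomplex (bc1 w)^* (- (bc2 w)^*).

Definition hyperbolic_nneg w : Prop :=
  exists x1 x2 : R, [/\ 0 <= x1, 0 <= x2
    & w = bc_e1 * bc_of_complex x1%:C + bc_e2 * bc_of_complex x2%:C].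

Lemma sqr_bc_i1 : bc_i1 * bc_i1 = -1.
Proof.
congr Bicomplex; rewrite /= ?mulr0 ?mul0r ?subr0 ?addr0 ?oppr0 //.
by apply/eqP; rewrite eq_complex /=; apply/andP; split; apply/eqP; ring.
Qed.

Lemma sqr_bc_i2 : bc_i2 * bc_i2 = -1.
Proof. by congr Bicomplex; rewrite /=; ring. Qed.

Lemma bcE w : w = bc_of_complex (bc1 w) + bc_of_complex (bc2 w) * bc_i2.
Proof. by case: w => a b; congr Bicomplex; rewrite /=; ring. Qed.

Lemma sqr_bc_j : bc_j * bc_j = 1.
Proof.
by rewrite /bc_j mulrACA sqr_bc_i1 sqr_bc_i2 mulrNN mulr1.
Qed.

Let half2 : bc_of_complex 2^-1 * 2 = 1.
Proof.
have -> : 2 = bc_of_complex 2 by congr Bicomplex; rewrite /= addr0.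
congr Bicomplex; rewrite /= ?(mulr0, mul0r, subr0, addr0) //.
by rewrite mulVf // pnatr_eq0.
Qed.

Lemma bc_e1De2 : bc_e1 + bc_e2 = 1.
Proof. by rewrite -half2 /bc_e1 /bc_e2; ring. Qed.

Lemma bc_e1Me2 : bc_e1 * bc_e2 = 0.
Proof.
rewrite /bc_e1 /bc_e2 mulrACA.
have -> : (1 + bc_j) * (1 - bc_j) = 1 - bc_j * bc_j by ring.
by rewrite sqr_bc_j subrr mulr0.
Qed.

Lemma bc_e1_idem : bc_e1 * bc_e1 = bc_e1.
Proof. by rewrite -[RHS]mulr1 -bc_e1De2 mulrDr bc_e1Me2 addr0. Qed.

Lemma bc_e2_idem : bc_e2 * bc_e2 = bc_e2.
Proof. by rewrite -[RHS]mul1r -bc_e1De2 mulrDl bc_e1Me2 add0r. Qed.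

End BicomplexTheory.

Section BicomplexModule.
Variables (R : realType) (M : lmodType (bicomplex R)).

Definition is_lincomb n (s : 'I_n -> M) (v : M) : Prop :=
  exists c : 'I_n -> bicomplex R, v = \sum_(i < n) c i *: s i.

Definition lin_indep n (s : 'I_n -> M) : Prop :=
  forall c : 'I_n -> bicomplex R,
    \sum_(i < n) c i *: s i = 0 -> forall i, c i = 0.

Definition is_basis n (s : 'I_n -> M) : Prop :=
  lin_indep s /\ forall v, is_lincomb s v.

Record bicomplex_scalar_product (sp : M -> M -> bicomplex R) : Prop := {
  bsp_add : forall u v w, sp u (v + w) = sp u v + sp u w;
  bsp_scale : forall (a : bicomplex R) u v, sp u (a *: v) = a * sp u v;
  bsp_dag3 : forall u v, sp u v = dag3 (sp v u);
  bsp_eq0 : forall u, sp u u = 0 <-> u = 0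
}.

Definition hyperbolic_positive (sp : M -> M -> bicomplex R) : Prop :=
  forall u, hyperbolic_nneg (sp u u).

Definition orthogonal_basis (sp : M -> M -> bicomplex R)
    n (t : 'I_n -> M) : Prop :=
  is_basis t /\ forall i j, i != j -> sp (t i) (t j) = 0.

End BicomplexModule.

(* Main.v *)
Require Import Defs.
From HB Require Import structures.
From mathcomp Require Import all_boot all_order all_algebra.
From mathcomp Require Import ring complex reals.

(** If [a * (u, u) = 0] then [(a u, a u) = 0], so [a u = 0]; when [u] belongs
    to a linearly independent family this forces [a = 0].  Thus [(u, u)] is not
    a zero divisor, and a bicomplex number that is not a zero divisor is
    invertible.  Hence Gram-Schmidt goes through as over a field: peel off the
    first vector, project the others onto its orthogonal complement, recurse. *)

Set Implicit Arguments.
Unset Strict Implicit.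
Unset Printing Implicit Defensive.

Import GRing.Theory.

Local Open Scope ring_scope.

Lemma bicomplex_regular_inv (R : realType) (w : bicomplex R) :
  (forall a, a * w = 0 -> a = 0) -> exists b, b * w = 1.
Proof.
case: w => x y reg; pose N := x * x + y * y.
(* The conjugate [x - y i2] multiplies [w] to [N]. *)
have [N0|N_neq0] := eqVneq N 0.
  have /reg [x0 /eqP] : Bicomplex x (- y) * Bicomplex x y = 0.
    by congr Bicomplex; rewrite /=; [rewrite -N0 /N|]; ring.
  rewrite oppr_eq0 => /eqP y0.
  (* Now [x] and [y] vanish, so [1] annihilates the number and regularity yields the absurd
     [1 = 0]. *)
  have /reg /eqP : 1 * Bicomplex x y = 0 by rewrite x0 y0 mul1r.
  by rewrite oner_eq0.
exists (Bicomplex (N^-1 * x) (- (N^-1 * y))).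
congr Bicomplex; last by rewrite /=; ring.
by rewrite /= -(mulVf N_neq0) /N; ring.
Qed.

Section GramSchmidt.
Variables (R : realType) (M : lmodType (bicomplex R)).

Lemma lin_indep_scale_eq0 n (s : 'I_n -> M) i a :
  lin_indep s -> a *: s i = 0 -> a = 0.
Proof.
move=> s_free asi0.
rewrite -(s_free (fun j => if j == i then a else 0) _ i) ?eqxx //.
rewrite (bigD1 i) //= eqxx asi0 add0r big1 // => j /negPf ->.
by rewrite scale0r.
Qed.

Variables (sp : M -> M -> bicomplex R) (Hsp : bicomplex_scalar_product sp).

Lemma sp_sumr n u (c : 'I_n -> bicomplex R) (s : 'I_n -> M) :
  sp u (\sum_(i < n) c i *: s i) = \sum_(i < n) c i * sp u (s i).
Proof.
elim: n c s => [|n IHn] c s.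
  (* Writing [0] as [0 *: 0] lets homogeneity settle the empty sum. *)
  by rewrite !big_ord0 -(scale0r 0) (bsp_scale Hsp) mul0r.
by rewrite !big_ord_recl (bsp_add Hsp) (bsp_scale Hsp) IHn.
Qed.

Lemma sp_orthoC u v : sp u v = 0 -> sp v u = 0.
Proof.
by move=> uv0; rewrite (bsp_dag3 Hsp) uv0; congr Bicomplex;
  apply/eqP; rewrite eq_complex /= !oppr0 !eqxx.
Qed.

Lemma sp_scale_eq0 a u : a * sp u u = 0 -> a *: u = 0.
Proof.
move=> auu0; apply/(bsp_eq0 Hsp).
(* Homogeneity is available on the right only; the factor on the left is handled by swapping
   [sp u (a *: u) = 0]. *)
by rewrite (bsp_scale Hsp) [sp _ u]sp_orthoC ?mulr0 // (bsp_scale Hsp).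
Qed.

(** Only independence is assumed because the induction runs on the projected tail, which need not
    generate [M]; equality of spans replaces generation. *)
Lemma gram_schmidt n (s : 'I_n -> M) : lin_indep s ->
  exists t : 'I_n -> M,
    [/\ forall l, is_lincomb s (t l),
        lin_indep t,
        forall v, is_lincomb s v -> is_lincomb t v
      & forall i j, i != j -> sp (t i) (t j) = 0].
Proof.
elim: n s => [|n IHn] s s_free; first by exists s; split=> // -[].
pose s0 := s ord0.
have s0_reg a : a * sp s0 s0 = 0 -> a = 0.
  by move/sp_scale_eq0; apply: lin_indep_scale_eq0.
have [b bK] := bicomplex_regular_inv s0_reg.
(* As [b] inverts [sp s0 s0], [k i *: s0] is the projection of the tail vector onto [s0]. *)
pose k i := b * sp s0 (s (lift ord0 i)).
pose s' i := s (lift ord0 i) - k i *: s0.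
have s'E c : \sum_(i < n) c i *: s' i
    = \sum_(i < n) c i *: s (lift ord0 i) - (\sum_(i < n) c i * k i) *: s0.
  rewrite scaler_suml -sumrB; apply: eq_bigr => i _.
  by rewrite scalerBr scalerA.
(* Prepends an entry to a family, of vectors or of coefficients. *)
pose cons T (x : T) (f : 'I_n -> T) i := oapp f x (unlift ord0 i).
have sum_cons x c u (f : 'I_n -> M) :
    \sum_(i < n.+1) cons _ x c i *: cons _ u f i
      = x *: u + \sum_(i < n) c i *: f i.
  rewrite big_ord_recl /cons unlift_none; congr (_ + _).
  by apply: eq_bigr => i _; rewrite liftK.
have s_cons i : s i = cons _ s0 (s \o lift ord0) i.
  by rewrite /cons; case: unliftP => [j|] ->.
have s_comb x c : \sum_(i < n.+1) cons _ x c i *: s i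
    = x *: s0 + \sum_(i < n) c i *: s (lift ord0 i).
  by rewrite -sum_cons; apply: eq_bigr => i _; rewrite s_cons.
have s'_free : lin_indep s'.
  move=> c; rewrite s'E => c0 i.
  (* A relation among the [s'] is a relation among the [s]: the tail coefficients are unchanged and
     [s0] collects the subtracted projections. *)
  have := s_free (cons _ (- \sum_(i < n) c i * k i) c) _ (lift ord0 i).
  by rewrite /cons liftK; apply; rewrite s_comb scaleNr addrC.
have s'_orth i : sp s0 (s' i) = 0.
  rewrite /s' (bsp_add Hsp) -scaleNr (bsp_scale Hsp) mulNr /k.
  by rewrite mulrAC bK mul1r subrr.
have [t [t_s' t_free s'_t t_orth]] := IHn _ s'_free.
have s0_t i : sp s0 (t i) = 0.
  have [c ->] := t_s' i; rewrite sp_sumr big1 // => j _.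
  by rewrite s'_orth mulr0.
exists (cons _ s0 t); split.
- move=> l; rewrite /cons; case: unliftP => [j|] _ /=.
    have [c ->] := t_s' j.
    exists (cons _ (- \sum_(i < n) c i * k i) c).
    by rewrite s_comb s'E scaleNr addrC.
  exists (cons _ 1 (fun=> 0)); rewrite s_comb scale1r big1 ?addr0 // => i _.
  by rewrite scale0r.
- move=> c; rewrite big_ord_recl /cons unlift_none /=.
  under eq_bigr do rewrite liftK /=.
  (* Pairing the relation with [s0] removes the tail and leaves [c ord0 * sp s0 s0 = 0]. *)
  move=> c0; have c00 : c ord0 = 0.
    apply: s0_reg; have := congr1 (sp s0) c0.
    rewrite (bsp_add Hsp) (bsp_scale Hsp) sp_sumr big1 ?addr0 => [->|i _].
      by rewrite -(scale0r 0) (bsp_scale Hsp) mul0r.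
    by rewrite s0_t mulr0.
  move: c0; rewrite c00 scale0r add0r => /t_free cl i.
  by case: (unliftP ord0 i) => [j|] ->.
- move=> _ [c ->].
  have [|d dE] := s'_t (\sum_(i < n) c (lift ord0 i) *: s' i).
    by exists (c \o lift ord0).
  (* Each tail vector is [s' i + k i *: s0], so the coefficient of [s0] absorbs the projections. *)
  exists (cons _ (c ord0 + \sum_(i < n) c (lift ord0 i) * k i) d).
  by rewrite sum_cons -dE s'E big_ord_recl scalerDl addrACA subrr addr0.
- move=> i j; rewrite /cons.
  case: (unliftP ord0 i) => [i'|] ->; case: (unliftP ord0 j) => [j'|] -> //=.
  + by rewrite (inj_eq lift_inj) => /t_orth.
  + by move=> _; apply: sp_orthoC.
Qed.

End GramSchmidt.

Theorem theorem4p8 (R : realType) (M : lmodType (bicomplex R))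
    (sp : M -> M -> bicomplex R)
    (Hsp : bicomplex_scalar_product sp)
    (Hpos : hyperbolic_positive sp)
    (n : nat) (s : 'I_n -> M) (Hs : is_basis s) :
  exists t : 'I_n -> M,
    (forall l : 'I_n, is_lincomb s (t l)) /\ orthogonal_basis sp t.
Proof.
have [s_free s_gen] := Hs.
have [t [t_s t_free s_t t_orth]] := gram_schmidt Hsp s_free.
by exists t; split=> //; split=> //; split=> // v; apply: s_t.
Qed.
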